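(* Let $(x_i,y_i)_{i=1}^n$ be training data with $x_i\in\mathbb{R}^d$, $\|x_i\|\le1$, $y_i\in\{-1,1\}$. Let $f_\theta$ be a $K$-layer neural network whose activation $\sigma$ is $H$-positively homogeneous and satisfies $\|\sigma(v)\|\le\|v\|^H$ for all $v$, and assume $K\ge2$, $H\ge1$. Let $L(\theta)=\frac1n\sum_{i=1}^n\ell(y_if_\theta(x_i))$ with logistic loss $\ell(z)=\ln(1+e^{-z})$ and $L_\lambda(\theta)=L(\theta)+\frac\lambda2\|\theta\|_2^2$. For any $\lambda>0$ such that $\theta$ is a non-zero stationary point of $L_\lambda$, we have $$\sum_{k=1}^K\frac{(H^{K-k})^{3/2}}{Z}\cdot\frac{\|W_k\|_2}{\|W_k\|_F}\;\ge\;\sqrt{\lambda}\,L(\theta)^{-\left(\frac14+\frac1{2Z}\right)},\qquad Z=\sum_{k=1}^K H^{K-k}.$$ (So $Z=K$ for $H=1$ and $Z=(H^K-1)/(H-1)$ otherwise.)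
   Context: Network: $f_\theta(x)=\langle w_K,h_{K-1}\rangle$, $h_k=\sigma(W_kh_{k-1})$ for $k\in\{1,\dots,K-1\}$, $h_0=x$, where $W_1\in\mathbb{R}^{m\times d}$, $W_k\in\mathbb{R}^{m\times m}$ for $2\le k\le K-1$, $w_K\in\mathbb{R}^m$, and $W_K:=w_K^\top$; $\theta=(\mathrm{vec}(W_1),\dots,\mathrm{vec}(W_K))$; $\sigma:\mathbb{R}^m\to\mathbb{R}^m$. $H$-positively homogeneous: $\sigma(\alpha v)=\alpha^H\sigma(v)$ for all $\alpha\ge0$ and all $v$. $\|\cdot\|_2$ is the spectral norm and $\|\cdot\|_F$ the Frobenius norm of a matrix. Stationary point of $L_\lambda$: $\lambda\theta=-\nabla L(\theta)$; in the non-smooth case, $\lambda\theta=-g$ for some $g\in\partial L(\theta)$, where for a locally Lipschitz $F$, $\partial F(\theta)=\mathrm{conv}\{g:\exists\,\theta_j\to\theta,\ \nabla F(\theta_j)\to g\}$ is the Clarke differential. Standing assumptions: $f_\theta(x)$ is locally Lipschitz in $\theta$, and the chain rule holds, i.e. $\frac{d}{dt}F(\theta(t))=\langle g,\dot\theta(t)\rangle$ for all $g\in\partial F(\theta(t))$. *)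

(* Defs.v *)
From HB Require Import structures.
From mathcomp Require Import all_boot all_order all_algebra.
From mathcomp Require Import all_classical all_reals all_analysis.

Set Implicit Arguments.
Unset Strict Implicit.
Unset Printing Implicit Defensive.

Import Order.TTheory GRing.Theory Num.Theory.
Import numFieldNormedType.Exports.

Local Open Scope classical_set_scope.
Local Open Scope ring_scope.

Section Norms.
Context {R : realType}.

(* On columns and rows this is the Euclidean norm; the library norm `|A| on
   matrices is the sup norm of the entries, which induces the same topology. *)
Definition frobenius (p q : nat) (A : 'M[R]_(p, q)) : R :=
  Num.sqrt (\sum_i \sum_j A i j ^+ 2).

Definition spectral (p q : nat) (A : 'M[R]_(p, q)) : R :=
  sup [set frobenius (A *m v) | v in [set v : 'cV[R]_q | frobenius v <= 1]].

Definition dot (p : nat) (u v : 'rV[R]_p) : R := \sum_j u 0 j * v 0 j.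

End Norms.

Section Clarke.
Context {R : realType} {p : nat}.
Implicit Types (F : 'rV[R]_p -> R) (theta g : 'rV[R]_p).

Definition gradient F theta : 'rV[R]_p := \row_j 'd F theta (delta_mx 0 j).

Definition limiting_gradients F theta : set 'rV[R]_p :=
  [set g | exists u : nat -> 'rV[R]_p,
     [/\ forall j, differentiable F (u j),
         u @ \oo --> theta &
         (fun j => gradient F (u j)) @ \oo --> g]].

Definition convex_hull (A : set 'rV[R]_p) : set 'rV[R]_p :=
  [set g | exists (N : nat) (c : 'I_N -> R) (v : 'I_N -> 'rV[R]_p),
     [/\ forall i, 0 <= c i, \sum_i c i = 1, forall i, A (v i) &
         g = \sum_i c i *: v i]].

Definition clarke F theta : set 'rV[R]_p :=
  convex_hull (limiting_gradients F theta).

Definition locally_lipschitz F : Prop :=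
  forall theta, exists2 U, nbhs theta U & [lipschitz F t | t in U].

Definition absolutely_continuous (gamma : R -> 'rV[R]_p) (a b : R) : Prop :=
  forall e : R, 0 < e -> exists2 delta : R, 0 < delta &
    forall (N : nat) (s t : 'I_N -> R),
      (forall i, [/\ a <= s i, s i <= t i & t i <= b]) ->
      (forall i j, i != j -> t i <= s j \/ t j <= s i) ->
      \sum_i (t i - s i) < delta ->
      \sum_i `|gamma (t i) - gamma (s i)| < e.

(* The rule can only be required for almost every time: for ReLU networks it
   fails, along some curves, at isolated times. *)
Definition chain_rule F : Prop :=
  forall gamma : R -> 'rV[R]_p,
    (forall a b : R, absolutely_continuous gamma a b) ->
    {ae @lebesgue_measure R, forall t : R,
       forall g, clarke F (gamma t) g ->
         is_derive t 1 (F \o gamma) (dot g ('D_1 gamma t))}.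

(* Stationarity for F + (lambda / 2) ||.||^2.  If F is differentiable at theta
   then its gradient there belongs to clarke F theta (constant sequence). *)
Definition regularized_stationary F (lambda : R) theta : Prop :=
  exists2 g, clarke F theta g & lambda *: theta = - g.

End Clarke.

Section Network.
Context {R : realType}.

(* The dimension of h_k, and hence the number of columns of W_(k+1). *)
Definition width (d m k : nat) : nat := if k is 0 then d else m.

(* The parameters are stored as the concatenation of vec(W_1), ..., vec(W_K):
   block number k (from 0) is W_(k+1), read row by row, and the final block is
   w_K.  Only K >= 2 is meant, and then w_K has dimension m. *)
Definition hidden_size (d m K : nat) : nat :=
  (\sum_(k < K.-1) m * width d m k)%N.

Definition params (d m K : nat) : nat :=
  (hidden_size d m K + width d m K.-1)%N.

(* W_k for 1 <= k <= K - 1; other values of k are irrelevant. *)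
Definition hidden_weight (d m K : nat) (theta : 'rV[R]_(params d m K))
    (k : nat) : 'M[R]_(m, width d m k.-1) :=
  match @idP (k.-1 < K.-1)%N with
  | ReflectT lt_k => vec_mx (submxrow (lsubmx theta) (Ordinal lt_k))
  | ReflectF _ => 0
  end.

Definition output_weight (d m K : nat) (theta : 'rV[R]_(params d m K)) :
    'cV[R]_(width d m K.-1) :=
  (rsubmx theta)^T.

(* phi W_k for 1 <= k <= K, where W_K is the row w_K^T. *)
Definition at_layer (phi : forall p q : nat, 'M[R]_(p, q) -> R)
    (d m K : nat) (theta : 'rV[R]_(params d m K)) (k : nat) : R :=
  if (k < K)%N then phi _ _ (hidden_weight theta k)
  else phi _ _ (output_weight theta)^T.

Fixpoint hidden (d m K : nat) (sigma : 'cV[R]_m -> 'cV[R]_m)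
    (theta : 'rV[R]_(params d m K)) (x : 'cV[R]_d) (k : nat) :
    'cV[R]_(width d m k) :=
  match k with
  | 0 => x
  | j.+1 => sigma (hidden_weight theta j.+1 *m hidden sigma theta x j)
  end.

Definition network (d m K : nat) (sigma : 'cV[R]_m -> 'cV[R]_m)
    (theta : 'rV[R]_(params d m K)) (x : 'cV[R]_d) : R :=
  dot (output_weight theta)^T (hidden sigma theta x K.-1)^T.

Definition pos_homogeneous (m : nat) (H : R) (sigma : 'cV[R]_m -> 'cV[R]_m) :=
  forall (alpha : R) (v : 'cV[R]_m), 0 <= alpha ->
    sigma (alpha *: v) = alpha `^ H *: sigma v.

Definition logistic (z : R) : R := ln (1 + expR (- z)).

Definition loss (d m K n : nat) (sigma : 'cV[R]_m -> 'cV[R]_m)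
    (x : 'I_n -> 'cV[R]_d) (y : 'I_n -> R)
    (theta : 'rV[R]_(params d m K)) : R :=
  n%:R^-1 * \sum_(i < n) logistic (y i * network sigma theta (x i)).

Definition degree_sum (K : nat) (H : R) : R :=
  \sum_(1 <= k < K.+1) H ^+ (K - k).

End Network.

(* Main.v *)
Require Import Defs.
From HB Require Import structures.
From mathcomp Require Import all_boot all_order all_algebra.
From mathcomp Require Import all_classical all_reals all_analysis.
From mathcomp Require Import ring lra.

(* Multiplying W_k by 1 + c multiplies the network by (1 + c)^(H^(K-k)).
   Differentiating the loss along this scaling, at points where the loss is
   differentiable, gives <grad_k L, W_k> = - H^(K-k) S with
   S = (1/n) sum_i margin z_i, z_i = y_i f(x_i) and margin z = - z l'(z).  Both
   sides are continuous in the parameters, so the identity survives limits of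
   gradients and convex combinations: it holds for every Clarke subgradient.
   At a stationary point lambda ||W_k||_F^2 = H^(K-k) S, hence S > 0, and the
   left-hand side equals
   sqrt (lambda / S) * sum_k (H^(K-k) / Z) ||W_k||_2, which by the weighted
   AM-GM inequality is at least sqrt (lambda / S) * M^(1/Z) with
   M = prod_k ||W_k||_2^(H^(K-k)) >= |f(x_i)|.  It remains to interpolate
   between S <= M L and S^2 <= L, using Z >= 2. *)

Set Implicit Arguments.
Unset Strict Implicit.
Unset Printing Implicit Defensive.

Import Order.TTheory GRing.Theory Num.Theory.
Import numFieldNormedType.Exports.

Local Open Scope classical_set_scope.
Local Open Scope ring_scope.

(** * Splitting the parameter vector into layers *)

Section LayerPart.
Context {R : realType}.

(** The direction along which only [W_k] is rescaled: [theta] with every other block set to zero.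
    Hidden blocks are indexed from 0, hence the test [i.+1 == k]. *)
Definition layer_part (d m K : nat) (theta : 'rV[R]_(params d m K)) (k : nat) :
    'rV[R]_(params d m K) :=
  row_mx
    (\mxrow_(i < K.-1) (if i.+1 == k then submxrow (lsubmx theta) i else 0))
    (if k == K then rsubmx theta else 0).

(** The layer part of the all-ones vector is a 0/1 mask independent of [theta]. This form gives
    continuity in [theta] and the sign of each term of an inner product. *)
Lemma layer_partE d m K (theta : 'rV[R]_(params d m K)) k j :
  layer_part theta k 0 j
  = layer_part (d := d) (m := m) (K := K) (const_mx 1) k 0 j * theta 0 j.
Proof.
rewrite -[in RHS](hsubmxK theta) /layer_part !mxE; case: (fintype.split j) => i.
  rewrite -[in RHS](submxrowK (lsubmx theta)) !mxE.
  by case: ifP => _; rewrite !mxE ?mul1r ?mul0r.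
by case: ifP => _; rewrite !mxE ?mul1r ?mul0r.
Qed.

Lemma dotE p (u v : 'rV[R]_p) : dot u v = (u *m v^T) 0 0.
Proof. by rewrite /dot mxE; apply: eq_bigr => j _; rewrite mxE. Qed.

Lemma frobenius_sqr p q (A : 'M[R]_(p, q)) :
  frobenius A ^+ 2 = \sum_i \sum_j A i j ^+ 2.
Proof. by rewrite sqr_sqrtr //; do 2!apply: sumr_ge0 => ? _; exact: sqr_ge0. Qed.

Lemma dot_vec p q (A : 'M[R]_(p, q)) (u : 'rV[R]_(p * q)) :
  A = vec_mx u -> dot u u = frobenius A ^+ 2.
Proof.
move=> ->; rewrite frobenius_sqr pair_bigA /=.
rewrite /dot (reindex _ (curry_mxvec_bij _ _)) /=.
by apply: eq_bigr => -[i j] _; rewrite !mxE expr2.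
Qed.

(** Removes the match on a bound proof in [hidden_weight]; boolean proofs are irrelevant, so any
    ordinal with the right value serves. *)
Lemma hidden_weightE d m K (theta : 'rV[R]_(params d m K)) (i : 'I_K.-1) :
  hidden_weight theta i.+1 = vec_mx (submxrow (lsubmx theta) i).
Proof.
case: i => i lt_i; rewrite /hidden_weight /=.
destruct (@idP (i < K.-1)%N) as [lt_i'|] => //.
by rewrite (bool_irrelevance lt_i' lt_i).
Qed.

Lemma hidden_weight_perturb d m K (theta : 'rV[R]_(params d m K)) k c j :
  (j < K.-1)%N ->
  hidden_weight (theta + c *: layer_part theta k) j.+1
  = (if j.+1 == k then 1 + c else 1) *: hidden_weight theta j.+1.
Proof.
move=> lt_j; rewrite (hidden_weightE _ (Ordinal lt_j)) /=.
rewrite (hidden_weightE _ (Ordinal lt_j)) -linearZ /=; congr vec_mx.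
have -> : submxrow (lsubmx (theta + c *: layer_part theta k)) (Ordinal lt_j)
    = submxrow (lsubmx theta) (Ordinal lt_j)
      + c *: submxrow (lsubmx (layer_part theta k)) (Ordinal lt_j).
  by apply/matrixP => i i'; rewrite !mxE.
rewrite row_mxKl mxrowK /=; case: ifP => _.
  by rewrite scalerDl scale1r.
by rewrite scaler0 addr0 scale1r.
Qed.

Lemma output_weight_perturb d m K (theta : 'rV[R]_(params d m K)) k c :
  output_weight (theta + c *: layer_part theta k)
  = (if k == K then 1 + c else 1) *: output_weight theta.
Proof.
rewrite /output_weight.
have -> : rsubmx (theta + c *: layer_part theta k)
    = rsubmx theta + c *: rsubmx (layer_part theta k).
  by apply/matrixP => i i'; rewrite !mxE.
by apply/colP => i; rewrite row_mxKr; case: ifP => _; rewrite !mxE; ring.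
Qed.

(** The inner product splits along the blocks, and only block [k] meets a non-zero block of the
    layer part. *)
Lemma dot_layer_part d m K (theta : 'rV[R]_(params d m K)) k :
  (1 <= k <= K)%N ->
  dot theta (layer_part theta k) = at_layer (@frobenius R) theta k ^+ 2.
Proof.
case: k => // k /= le_kK.
rewrite dotE -{1}(hsubmxK theta) /layer_part tr_row_mx mul_row_col mxE.
rewrite -{1}(submxrowK (lsubmx theta)) tr_mxrow mul_mxrow_mxcol summxE.
rewrite /at_layer; case: ltnP => [lt_kK|le_Kk].
  have lt_k : (k < K.-1)%N by rewrite -ltnS prednK // (leq_ltn_trans _ lt_kK).
  rewrite (ltn_eqF lt_kK) trmx0 mulmx0 mxE addr0.
  rewrite (bigD1 (Ordinal lt_k)) //= eqxx -dotE big1 ?addr0.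
    exact/dot_vec/(hidden_weightE _ (Ordinal lt_k)).
  move=> i ne_i; rewrite eqSS (_ : (i == k :> nat) = false) ?trmx0 ?mulmx0 ?mxE//.
  by apply: contra_neqF ne_i => /eqP ik; apply: val_inj.
have -> : k.+1 == K by rewrite eqn_leq le_kK.
rewrite big1 => [|i _].
  rewrite add0r -dotE frobenius_sqr big_ord1 /dot /output_weight trmxK.
  by apply: eq_bigr => i _; rewrite expr2.
rewrite (_ : (i.+1 == k.+1) = false) ?trmx0 ?mulmx0 ?mxE//.
rewrite eqSS ltn_eqF // (leq_trans (ltn_ord i)) // -ltnS prednK //.
exact: leq_ltn_trans le_kK.
Qed.

(** Each inner product of [theta] with a layer part is a sum of nonnegative terms, mask times
    square. If it vanishes, so does the layer part, and the layer parts together recover every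
    block. *)
Lemma params_eq0 d m K (theta : 'rV[R]_(params d m K)) : (0 < K)%N ->
  (forall k, (1 <= k <= K)%N -> at_layer (@frobenius R) theta k = 0) ->
  theta = 0.
Proof.
move=> K_gt0 theta_k.
have part0 k : (1 <= k <= K)%N -> layer_part theta k = 0.
  move=> leK; apply/rowP => j; rewrite [RHS]mxE.
  have := dot_layer_part theta leK; rewrite theta_k // expr0n /= /dot => /eqP.
  rewrite psumr_eq0 => [/allP /(_ j (mem_index_enum _)) /=|i _].
    rewrite mulf_eq0 => /orP[|] /eqP //; rewrite layer_partE => ->.
    by rewrite mulr0.
  rewrite layer_partE mulrCA -expr2 mulr_ge0 ?sqr_ge0 //.
  rewrite /layer_part !mxE.
  by case: (fintype.split i) => i'; rewrite ?mxE; case: ifP => _;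
    rewrite ?mxE ?ler01.
rewrite -(hsubmxK theta) -[RHS](hsubmxK 0); congr row_mx.
  rewrite -(submxrowK (lsubmx theta)) -[RHS](submxrowK _); apply/eq_mxrowP => i.
  have /part0 /(congr1 lsubmx) : (1 <= i.+1 <= K)%N.
    by rewrite (leq_trans (ltn_ord i)) ?leq_pred.
  rewrite row_mxKl => /(congr1 (fun A => submxrow A i)).
  by rewrite mxrowK eqxx.
have /part0 /(congr1 rsubmx) : (1 <= K <= K)%N by rewrite leqnn andbT.
by rewrite row_mxKr eqxx.
Qed.

End LayerPart.

(** * Frobenius and spectral norms *)

Section Norms.
Context {R : realType}.

Lemma frobenius_ge0 p q (A : 'M[R]_(p, q)) : 0 <= frobenius A.
Proof. exact: sqrtr_ge0. Qed.

Lemma frobeniusZ p q (c : R) (A : 'M[R]_(p, q)) :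
  frobenius (c *: A) = `|c| * frobenius A.
Proof.
rewrite /frobenius -sqrtr_sqr -sqrtrM ?sqr_ge0 //; congr Num.sqrt.
rewrite mulr_sumr; apply: eq_bigr => i _.
by rewrite mulr_sumr; apply: eq_bigr => j _; rewrite mxE exprMn.
Qed.

Lemma le_frobenius p q (A : 'M[R]_(p, q)) i j : `|A i j| <= frobenius A.
Proof.
rewrite /frobenius -sqrtr_sqr ler_sqrt; last first.
  by do 2!apply: sumr_ge0 => ? _; exact: sqr_ge0.
rewrite (bigD1 i) //= (bigD1 j) //= -addrA lerDl addr_ge0 //.
  by apply: sumr_ge0 => ? _; exact: sqr_ge0.
by do 2!apply: sumr_ge0 => ? _; exact: sqr_ge0.
Qed.

Lemma frobenius_eq0 p q (A : 'M[R]_(p, q)) : frobenius A = 0 -> A = 0.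
Proof.
move=> A0; apply/matrixP => i j; rewrite mxE; apply/eqP.
by rewrite -normr_le0 -A0 le_frobenius.
Qed.

Lemma frobenius0 p q : frobenius (0 : 'M[R]_(p, q)) = 0.
Proof. by rewrite -(scale0r 0) frobeniusZ normr0 mul0r. Qed.

(** Needed because [sup] is meaningful only for nonempty bounded sets. Entries of [v] are at most 1
    in absolute value, so row [i] of [A *m v] is bounded by the sum of the [|A i j|]. *)
Lemma spectral_has_sup p q (A : 'M[R]_(p, q)) :
  has_sup [set frobenius (A *m v) | v in [set v : 'cV[R]_q | frobenius v <= 1]].
Proof.
split; first by exists (frobenius (A *m (0 : 'cV[R]_q))), 0 => //=; rewrite frobenius0.
exists (Num.sqrt (\sum_(i < p) \sum_(k < 1) (\sum_j `|A i j|) ^+ 2)).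
move=> _ [v /= v1 <-]; apply: ler_wsqrtr.
apply: ler_sum => i _; apply: ler_sum => k _.
rewrite -[leLHS]real_normK ?num_real // ler_sqr ?nnegrE ?normr_ge0 //; last first.
  by apply: sumr_ge0 => ? _.
rewrite mxE; apply: le_trans (ler_norm_sum _ _ _) _; apply: ler_sum => j _.
by rewrite normrM ler_piMr // (le_trans (le_frobenius _ _ _)).
Qed.

Lemma spectral_ge0 p q (A : 'M[R]_(p, q)) : 0 <= spectral A.
Proof.
apply: (ub_le_sup (spectral_has_sup A).2).
by exists 0; rewrite /= ?mulmx0 frobenius0.
Qed.

Lemma frobenius_mulmx p q (A : 'M[R]_(p, q)) (v : 'cV[R]_q) :
  frobenius (A *m v) <= spectral A * frobenius v.
Proof.
have [/frobenius_eq0 ->|v_neq0] := eqVneq (frobenius v) 0.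
  by rewrite mulmx0 !frobenius0 mulr0.
have v_gt0 : 0 < frobenius v by rewrite lt0r v_neq0 frobenius_ge0.
rewrite -ler_pdivrMr // mulrC.
have -> : (frobenius v)^-1 * frobenius (A *m v)
    = frobenius (A *m ((frobenius v)^-1 *: v)).
  by rewrite -scalemxAr frobeniusZ ger0_norm // invr_ge0 ltW.
apply: (ub_le_sup (spectral_has_sup A).2); exists ((frobenius v)^-1 *: v) => //=.
by rewrite frobeniusZ ger0_norm ?mulVf // invr_ge0 ltW.
Qed.

End Norms.

(** * Homogeneity and size of the network *)

Section Network.
Context {R : realType} (d m K : nat) (H : R) (sigma : 'cV[R]_m -> 'cV[R]_m).
Hypothesis sigma_hom : pos_homogeneous H sigma.
Implicit Types (theta : 'rV[R]_(params d m K)) (x : 'cV[R]_d).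

(** The factor [1 + c] enters at layer [k] and each activation from there on multiplies its exponent
    by [H]. Positive homogeneity requires [0 <= 1 + c]. *)
Lemma hidden_layer_part theta x k c j : (j < K)%N -> (0 < k)%N -> -1 <= c ->
  hidden sigma (theta + c *: layer_part theta k) x j
  = (if (k <= j)%N then (1 + c) `^ (H ^+ (j.+1 - k)) else 1)
    *: hidden sigma theta x j.
Proof.
move=> lt_jK k_gt0 c_ge; elim: j lt_jK => [|j IHj] lt_jK.
  by rewrite leqn0 gtn_eqF // scale1r.
have c1_ge0 : 0 <= 1 + c by rewrite -lerBlDl sub0r.
rewrite /= hidden_weight_perturb; last first.
  by rewrite -ltnS prednK // (leq_ltn_trans _ lt_jK).
rewrite (IHj (ltnW lt_jK)) -scalemxAl -scalemxAr scalerA sigma_hom; last first.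
  by apply: mulr_ge0; case: ifP => _; rewrite ?powR_ge0.
(* Layer [k] lies before, after, or exactly at the layer being added. *)
congr (_ *: _); case: (ltngtP k j.+1) => [lt_kj|lt_jk|->].
- by rewrite -ltnS lt_kj mul1r -powRrM -exprSr -subSn // ltnW.
- by rewrite leqNgt (ltnW lt_jk) mul1r powR1.
- by rewrite ltnn mulr1 subSnn.
Qed.

Lemma network_layer_part theta x k c : (1 <= k <= K)%N -> -1 <= c ->
  network sigma (theta + c *: layer_part theta k) x
  = (1 + c) `^ (H ^+ (K - k)) * network sigma theta x.
Proof.
move=> /andP[k_gt0 le_kK] c_ge.
have K_gt0 := leq_trans k_gt0 le_kK.
rewrite /network output_weight_perturb hidden_layer_part ?ltn_predL //.
rewrite !dotE !trmxK linearZ /= [(_ *: _)^T]linearZ /= -scalemxAl scalerA mxE.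
rewrite /output_weight trmxK; congr (_ * _); rewrite prednK //.
have -> : (k <= K.-1)%N = (k < K)%N by rewrite -ltnS prednK.
(* The last layer has no activation: for [k = K] the factor comes from the output weight alone,
   otherwise from the last hidden layer alone. *)
have [->|ne_kK] := eqVneq k K.
  by rewrite ltnn subnn expr0 mul1r powRr1 // -lerBlDl sub0r.
by rewrite ltn_neqAle ne_kK le_kK mulr1.
Qed.

Hypothesis H_ge1 : 1 <= H.
Hypothesis sigma_bound : forall v, frobenius (sigma v) <= frobenius v `^ H.

(** Each layer multiplies the bound by a spectral norm and then raises it to the power [H]. *)
Lemma frobenius_hidden theta x j : (j < K)%N -> frobenius x <= 1 ->
  frobenius (hidden sigma theta x j)
  <= \prod_(1 <= i < j.+1) at_layer (@spectral R) theta i `^ (H ^+ (j.+1 - i)).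
Proof.
move=> lt_jK x1; elim: j lt_jK => [|j IHj] lt_jK; first by rewrite big_nil.
apply: le_trans (sigma_bound _) _; rewrite big_nat_recr //= subSnn expr1.
have H_ge0 : 0 <= H by rewrite (le_trans _ H_ge1).
have powR_prod (s : seq nat) (F : nat -> R) : (forall i, 0 <= F i) ->
    (\prod_(i <- s) F i) `^ H = \prod_(i <- s) F i `^ H.
  move=> F_ge0; elim: s => [|i s IHs]; first by rewrite !big_nil powR1.
  by rewrite !big_cons powRM ?IHs // prodr_ge0.
have -> : \prod_(1 <= i < j.+1) at_layer (@spectral R) theta i `^ (H ^+ (j.+2 - i))
    = (\prod_(1 <= i < j.+1)
         at_layer (@spectral R) theta i `^ (H ^+ (j.+1 - i))) `^ H.
  rewrite powR_prod => [|i]; last exact: powR_ge0.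
  apply: eq_big_nat => i /andP[_ le_ij].
  by rewrite -powRrM -exprSr -subSn // ltnW.
have s_ge0 : 0 <= at_layer (@spectral R) theta j.+1.
  by rewrite /at_layer; case: ifP => _; exact: spectral_ge0.
have p_ge0 : 0 <= \prod_(1 <= i < j.+1)
    at_layer (@spectral R) theta i `^ (H ^+ (j.+1 - i)).
  by apply: prodr_ge0 => i _; exact: powR_ge0.
rewrite -powRM //; apply: ge0_ler_powR => //; rewrite ?nnegrE ?mulr_ge0 //.
  exact: frobenius_ge0.
apply: le_trans (frobenius_mulmx _ _) _; rewrite mulrC /at_layer lt_jK.
by apply: ler_wpM2r; rewrite ?spectral_ge0 // IHj // ltnW.
Qed.

Lemma norm_network theta x : (0 < K)%N -> frobenius x <= 1 ->
  `|network sigma theta x|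
  <= \prod_(1 <= i < K.+1) at_layer (@spectral R) theta i `^ (H ^+ (K - i)).
Proof.
move=> K_gt0 x1; rewrite big_nat_recr //= subnn expr0 /at_layer ltnn.
rewrite powRr1 ?spectral_ge0 //.
(* The output is the entry of a 1 by 1 matrix, hence bounded by its Frobenius norm. *)
rewrite /network dotE trmxK; apply: le_trans (le_frobenius _ _ _) _.
apply: le_trans (frobenius_mulmx _ _) _; rewrite mulrC.
apply: ler_wpM2r; first exact: spectral_ge0.
have := @frobenius_hidden theta x K.-1; rewrite ltn_predL prednK //; exact.
Qed.

End Network.

(** * Derivatives of the logistic loss *)

Section Logistic.
Context {R : realType}.
Implicit Types z w a : R.

(* margin z = - z * logistic' z *)
Definition margin z := z / (1 + expR z).

Lemma is_derive_logistic z :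
  is_derive z 1 (@logistic R) (- (1 + expR z)^-1).
Proof.
have d_pos : 0 < 1 + expR (- z) by rewrite addr_gt0 ?expR_gt0.
have dN : is_derive z 1 (expR \o -%R) (expR (- z) * -1).
  exact: is_derive1_comp.
have d1 : is_derive z 1 (cst 1 + (expR \o -%R)) (0 + expR (- z) * -1).
  exact: is_deriveD.
have dl := @is_derive1_comp R (@ln R) (cst 1 + (expR \o -%R)) z _ _
  (is_derive1_ln d_pos) d1.
apply: (is_derive_eq dl).
rewrite add0r mulrN1 mulrN expRN; congr (- _).
by field; rewrite !gt_eqF ?addr_gt0 ?expR_gt0.
Qed.

Lemma is_derive_logistic_powR a w :
  is_derive (0 : R) 1 (fun c => logistic ((1 + c) `^ a * w)) (- (a * margin w)).
Proof.
have d1 : is_derive (0 : R) 1 (cst 1 + id) (0 + 1) by exact: is_deriveD.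
have d2 : is_derive ((cst 1 + id) (0 : R)) 1 ((@powR R) ^~ a) a.
  rewrite [X in is_derive X](_ : _ = 1); last by rewrite !fctE addr0.
  apply: (is_derive_eq (is_derive1_powR a ltr01)).
  by rewrite powR1 mulr1.
have d3 := @is_derive1_comp R ((@powR R) ^~ a) (cst 1 + id) 0 _ _ d2 d1.
have d4 : is_derive (0 : R) 1 (w \*: (((@powR R) ^~ a) \o (cst 1 + id)))
    (w *: (a * (0 + 1))) by exact: is_deriveZ.
have d5 : is_derive ((w \*: (((@powR R) ^~ a) \o (cst 1 + id))) (0 : R)) 1
    (@logistic R) (- (1 + expR w)^-1).
  rewrite [X in is_derive X](_ : _ = w); first exact: is_derive_logistic.
  by rewrite !fctE /= addr0 powR1 [LHS]mulr1.
have d6 := @is_derive1_comp R (@logistic R) _ 0 _ _ d5 d4.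
rewrite (_ : (fun c => _) =
  @logistic R \o (w \*: (((@powR R) ^~ a) \o (cst 1 + id)))); last first.
  by apply/funext => c /=; rewrite mulrC.
apply: (is_derive_eq d6).
by rewrite add0r mulr1 /margin /GRing.scale /=; ring.
Qed.

Lemma continuous_margin : continuous margin.
Proof.
move=> z; apply: cvgM; first exact: cvg_id.
apply: cvgV; first by rewrite gt_eqF // addr_gt0 ?expR_gt0.
by apply: cvgD; [exact: cvg_cst|exact: continuous_expR].
Qed.

End Logistic.

(** * Gradients, local Lipschitz continuity and convex hulls *)

Section Clarke.
Context {R : realType} {p : nat}.
Implicit Types (F : 'rV[R]_p -> R) (theta g v : 'rV[R]_p).

Lemma dot_gradient F theta v :
  differentiable F theta -> dot (gradient F theta) v = 'D_v F theta.
Proof.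
move=> dF; rewrite deriveE // [in RHS](row_sum_delta v) linear_sum.
by apply: eq_bigr => j _; rewrite linearZ mxE mulrC.
Qed.

(** Agreement only near 0 is assumed because the scaling formula for the network holds only for
    [-1 <= c]. *)
Lemma is_derive_dot_gradient F theta v (f : R -> R) l :
  differentiable F theta ->
  (\forall c \near (0 : R), F (theta + c *: v) = f c) ->
  is_derive (0 : R) 1 f l -> dot (gradient F theta) v = l.
Proof.
move=> dF Ff fl; rewrite dot_gradient //.
have -> : 'D_v F theta = 'D_1 (fun c : R => F (theta + c *: v)) 0.
  rewrite /derive; set f1 := fun h => h^-1 *: _; set f2 := fun h => h^-1 *: _.
  suff -> : f1 = f2 by []; apply/funext => h; rewrite /f1 /f2 /=.
  by rewrite addr0 scale0r addr0 [_%:A]mulr1 (addrC theta).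
by rewrite (near_eq_derive _ Ff) derive_val.
Qed.

Lemma locally_lipschitz_continuous F : locally_lipschitz F -> continuous F.
Proof.
move=> F_lip theta; have [U U_theta [M [_ /(_ (Num.max M 0 + 1))]]] := F_lip theta.
(* [M] is a threshold beyond which every constant is a Lipschitz constant; [k] exceeds it and is
   positive. *)
set k := Num.max M 0 + 1.
have k_gt0 : 0 < k by rewrite ltr_wpDl // le_max lexx orbT.
have -> : M < k by rewrite ltr_pwDr // le_max lexx.
move=> /(_ isT) F_k; apply/(@cvgrPdist_lt _ _ _ (nbhs theta)) => e e_gt0; near=> t.
have U_t : U t by near: t; exact: U_theta.
have /= F_t := F_k (theta, t) (conj (nbhs_singleton U_theta) U_t).
apply: le_lt_trans F_t _.
rewrite mulrC -ltr_pdivlMr //; near: t.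
by apply: cvgr_dist_lt; [exact: cvg_id|exact: divr_gt0].
Unshelve. all: by end_near. Qed.

(** The weights of a convex combination sum to 1, so a linear form constant on [A] keeps its
    value. *)
Lemma convex_hull_dot (A : set 'rV[R]_p) v l g :
  (forall h, A h -> dot h v = l) -> convex_hull A g -> dot g v = l.
Proof.
move=> Al [N [c [w [_ c1 Aw ->]]]].
transitivity (\sum_i c i * dot (w i) v).
  rewrite dotE mulmx_suml summxE; apply: eq_bigr => i _.
  by rewrite -scalemxAl mxE dotE.
by under eq_bigr do rewrite Al //; rewrite -mulr_suml c1 mul1r.
Qed.

End Clarke.

(** * Scalar inequalities *)

Section RealInequalities.
Context {R : realType}.

(** The left-hand side is minus the derivative of [logistic]. The bound is [ln (1 + u) <= u] at
    [u = - (1 + expR z)^-1]. *)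
Lemma logistic_ge (z : R) : (1 + expR z)^-1 <= logistic z.
Proof.
have ez := expR_gt0 z.
have d_gt0 : 0 < 1 + expR (- z) by rewrite addr_gt0 ?expR_gt0.
rewrite /logistic -[ln _]opprK -lnV ?posrE // lerNr.
have -> : (1 + expR (- z))^-1 = 1 + (- (1 + expR z)^-1).
  by rewrite expRN; field; rewrite !gt_eqF ?addr_gt0 // expR_gt0.
apply: le_ln1Dx; rewrite ltrN2 invf_lt1 ?addr_gt0 //; lra.
Qed.

Lemma logistic_gt0 (z : R) : 0 < logistic z.
Proof. by rewrite (lt_le_trans _ (logistic_ge z)) // invr_gt0 addr_gt0 ?expR_gt0. Qed.

Lemma sqr_le_expR (z : R) : 0 <= z -> z ^+ 2 <= 1 + expR z.
Proof.
move=> z_ge0.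
have h : (1 + z / 4) ^+ 4 <= expR z.
  have -> : expR z = expR (z / 4) ^+ 4.
    by rewrite -expRM_natr; congr expR; field.
  by apply: lerXn2r; rewrite ?nnegrE ?expR_ge0 ?expR_ge1Dx //; lra.
apply: le_trans (_ : 1 + (1 + z / 4) ^+ 4 <= _); last by rewrite lerD2l.
(* Indeed [1 + (1 + z/4)^4 - z^2 = 1 + z (z - 4)^2 / 16 + (z^2/16 - 1)^2]. *)
have := mulr_ge0 z_ge0 (sqr_ge0 (z - 4)); have := sqr_ge0 (z ^+ 2 / 16 - 1).
lra.
Qed.

Lemma margin_le_logistic (z M : R) : `|z| <= M -> margin z <= M * logistic z.
Proof.
move=> zM; have M_ge0 := le_trans (normr_ge0 z) zM.
apply: le_trans (_ : M * (1 + expR z)^-1 <= _); last first.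
  exact: ler_wpM2l (logistic_ge z).
apply: ler_wpM2r; first by rewrite invr_ge0 addr_ge0 ?expR_ge0.
exact: le_trans (ler_norm z) zM.
Qed.

(** For [z >= 0], [margin z ^+ 2 <= logistic z] and a square is completed; for [z < 0] the left-hand
    side is nonpositive. Averaged over the data with [s = S], it gives [S ^+ 2 <= L]. *)
Lemma margin_young (z s : R) : 0 <= s ->
  2 * s * margin z <= logistic z + s ^+ 2.
Proof.
move=> s_ge0; have l_gt0 := logistic_gt0 z.
have e_gt0 : 0 < 1 + expR z by rewrite addr_gt0 ?expR_gt0.
have [z_ge0|z_lt0] := leP 0 z.
  have margin2 : margin z ^+ 2 <= logistic z.
    apply: le_trans (logistic_ge z); rewrite /margin expr_div_n.
    rewrite ler_pdivrMr ?exprn_gt0 // expr2 (expr2 (1 + _)) mulKf ?gt_eqF //.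
    by rewrite -expr2 sqr_le_expR.
  have := sqr_ge0 (margin z - s); nra.
have m_le0 : margin z <= 0 by rewrite /margin nmulr_rle0 // invr_ge0 ltW.
have := mulr_ge0_le0 s_ge0 m_le0; have := sqr_ge0 s; lra.
Qed.

Lemma weighted_am_gm (I : eqType) (r : seq I) (a s : I -> R) :
  (forall i, 0 < a i) -> (forall i, 0 <= s i) ->
  let Z := \sum_(i <- r) a i in
  0 < Z ->
  (\prod_(i <- r) s i `^ a i) `^ (1 / Z) <= (\sum_(i <- r) a i * s i) / Z.
Proof.
move=> a_gt0 s_ge0 Z Z_gt0; set P := \prod_(i <- r) _.
have [->|P_neq0] := eqVneq P 0.
  rewrite powR0 ?gt_eqF ?divr_gt0 //; apply: divr_ge0 (ltW Z_gt0).
  by apply: sumr_ge0 => i _; rewrite mulr_ge0 // ltW.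
have s_gt0 i : i \in r -> 0 < s i.
  move=> ri; rewrite lt0r s_ge0 andbT; apply: contra_neq P_neq0 => si0.
  by rewrite /P (big_rem i) //= si0 powR0 ?gt_eqF // mul0r.
have P_gt0 : 0 < P.
  by rewrite lt0r P_neq0; apply: prodr_ge0 => i _; exact: powR_ge0.
have lnP : ln P = \sum_(i <- r) a i * ln (s i).
  rewrite /P {P P_neq0 P_gt0 Z Z_gt0}; elim: r s_gt0 => [|i r IHr] s_gt0.
    by rewrite !big_nil ln1.
  rewrite !big_cons lnM ?posrE ?powR_gt0 ?s_gt0 ?mem_head //.
    by rewrite ln_powR IHr // => j rj; rewrite s_gt0 // in_cons rj orbT.
  rewrite big_seq; apply: prodr_gt0 => j rj.
  by rewrite powR_gt0 // s_gt0 // in_cons rj orbT.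
(* With [G] the geometric mean, the weighted sum of [ln (s i / G)] vanishes, and [ln u <= u - 1] is
   summed at [u = s i / G]. *)
set G := P `^ _; have G_gt0 : 0 < G by exact: powR_gt0.
have lnG : Z * ln G = ln P by rewrite ln_powR; field; rewrite gt_eqF.
have : \sum_(i <- r) a i * (ln (s i) - ln G) <= \sum_(i <- r) a i * (s i / G - 1).
  rewrite big_seq [leRHS]big_seq; apply: ler_sum => i ri.
  apply: ler_wpM2l; first exact: ltW.
  rewrite -ln_div ?posrE ?s_gt0 //.
  have -> : s i / G = 1 + (s i / G - 1) by ring.
  rewrite [X in _ <= X - 1]addrC subrK.
  by apply: le_ln1Dx; rewrite ltrBrDl subrr divr_gt0 ?s_gt0.
have -> : \sum_(i <- r) a i * (ln (s i) - ln G) = 0.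
  under eq_bigr do rewrite mulrBr.
  by rewrite sumrB -lnP -mulr_suml lnG subrr.
have -> : \sum_(i <- r) a i * (s i / G - 1) = (\sum_(i <- r) a i * s i) / G - Z.
  by under eq_bigr do rewrite mulrBr mulr1 mulrA; rewrite sumrB -mulr_suml.
rewrite subr_ge0 ler_pdivlMr // => GZ.
by rewrite ler_pdivlMr // mulrC.
Qed.

(** With [w = 1/Z], write [sqrt S = S^w S^(1/2 - w)]; bound the first factor by [S <= M L] and the
    second by [S <= sqrt L]. The condition [2 <= Z] makes [1/2 - w] nonnegative. The proof takes
    logarithms. *)
Lemma powR_interpolation (S M L Z : R) :
  0 < S -> 0 <= M -> S <= M * L -> S ^+ 2 <= L -> 2 <= Z ->
  Num.sqrt S * L `^ (- (1 / 4 + 1 / (2 * Z))) <= M `^ (1 / Z).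
Proof.
move=> S_gt0 M_ge0 S_ML S2_L Z_ge2.
have L_gt0 : 0 < L by rewrite (lt_le_trans _ S2_L) ?exprn_gt0.
have M_gt0 : 0 < M by rewrite -(pmulr_lgt0 _ L_gt0) (lt_le_trans S_gt0).
have lnS1 : ln S <= ln M + ln L.
  by rewrite -lnM ?posrE // ler_ln ?posrE // mulr_gt0.
have lnS2 : ln S *+ 2 <= ln L by rewrite -lnXn // ler_ln ?posrE ?exprn_gt0.
rewrite -powR12_sqrt ?(ltW S_gt0) // -ler_ln ?posrE ?mulr_gt0 ?powR_gt0 //.
rewrite lnM ?posrE ?powR_gt0 // !ln_powR.
have -> : 1 / (2 * Z) = Z^-1 / 2 by field; lra.
rewrite div1r; have : 0 < Z^-1 <= 2^-1 by rewrite invr_gt0 lef_pV2 ?posrE; lra.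
move: (Z^-1) => w /andP[w_gt0 w_le].
have h1 : w * ln S <= w * (ln M + ln L) by rewrite ler_pM2l.
have h2 : (2^-1 - w) * (ln S *+ 2) <= (2^-1 - w) * ln L.
  by apply: ler_wpM2l => //; rewrite subr_ge0.
lra.
Qed.

End RealInequalities.

(** * Clarke subgradients of the loss and stationarity *)

Lemma cvg_dot_layer_part {R : realType} d m K k
    (g u : nat -> 'rV[R]_(params d m K)) a b :
  g @ \oo --> a -> u @ \oo --> b ->
  dot (g j) (layer_part (u j) k) @[j --> \oo] --> dot a (layer_part b k).
Proof.
move=> ga ub; rewrite /dot.
apply: cvg_big => [|i _]; first exact: add_continuous.
apply: cvgM; first exact: (cvg_comp _ _ ga (@coord_continuous _ _ _ 0 i a)).
rewrite layer_partE; under eq_cvg do rewrite layer_partE.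
apply: cvgM; first exact: cvg_cst.
exact: (cvg_comp _ _ ub (@coord_continuous _ _ _ 0 i b)).
Qed.

Section Loss.
Context {R : realType} (d m K n : nat) (H : R) (sigma : 'cV[R]_m -> 'cV[R]_m).
Context (x : 'I_n -> 'cV[R]_d) (y : 'I_n -> R).
Hypothesis sigma_hom : pos_homogeneous H sigma.
Implicit Types theta : 'rV[R]_(params d m K).

(** The quantity S, common to all layers: scaling [W_k] changes the loss at rate [- H ^+ (K - k)]
    times S. *)
Definition mean_margin theta : R :=
  n%:R^-1 * \sum_(i < n) margin (y i * network sigma theta (x i)).

Lemma gradient_layer_part theta k : (1 <= k <= K)%N ->
  differentiable (loss sigma x y) theta ->
  dot (gradient (loss sigma x y) theta) (layer_part theta k)
  = - (H ^+ (K - k) * mean_margin theta).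
Proof.
move=> leK dL; set a := H ^+ (K - k).
pose w i := y i * network sigma theta (x i).
pose f := n%:R^-1 \*: \sum_(i < n) (fun c : R => logistic ((1 + c) `^ a * w i)).
have fE c : f c = n%:R^-1 * \sum_(i < n) logistic ((1 + c) `^ a * w i).
  by rewrite /f /= fct_sumE.
apply: (is_derive_dot_gradient (f := f) dL).
  near=> c.
  have c_ge : -1 <= c by apply: ltW; near: c; apply: lt_nbhsr; rewrite ltrN10.
  rewrite fE /loss; congr (_ * _); apply: eq_bigr => i _.
  by rewrite (network_layer_part sigma_hom theta (x i) leK c_ge) mulrCA.
have df : is_derive (0 : R) 1 f
    (n%:R^-1 *: \sum_(i < n) - (a * margin (w i))).
  by apply: is_deriveZ; apply: is_derive_sum => i; exact: is_derive_logistic_powR.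
apply: (is_derive_eq df).
by rewrite sumrN -mulr_sumr /mean_margin [LHS]mulrN mulrCA.
Unshelve. all: by end_near. Qed.

Hypothesis net_lip : forall z : 'cV[R]_d,
  locally_lipschitz (fun t : 'rV[R]_(params d m K) => network sigma t z).

Lemma cvg_mean_margin (u : nat -> 'rV[R]_(params d m K)) theta :
  u @ \oo --> theta -> mean_margin (u j) @[j --> \oo] --> mean_margin theta.
Proof.
move=> u_theta; apply: cvgMl_tmp.
apply: cvg_big => [|i _]; first exact: add_continuous.
apply: continuous_cvg; first exact: continuous_margin.
apply: cvgMl_tmp.
exact: cvg_comp u_theta
  (@locally_lipschitz_continuous _ _ _ (net_lip (x i)) theta).
Qed.

Lemma clarke_layer_part theta g k : (1 <= k <= K)%N ->
  clarke (loss sigma x y) theta g ->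
  dot g (layer_part theta k) = - (H ^+ (K - k) * mean_margin theta).
Proof.
move=> leK; apply: convex_hull_dot => {}g [u [du u_theta gu_g]].
(* The direction moves with the sequence: at [u j] the identity concerns the layer part of [u j], so
   both arguments of the inner product converge. *)
have := cvg_dot_layer_part (k := k) gu_g u_theta.
under eq_cvg do rewrite gradient_layer_part //.
move/cvg_lim => <- //; apply: cvg_lim => //.
by apply: cvgN; apply: cvgMl_tmp; exact: cvg_mean_margin.
Qed.

(** Pair [lambda *: theta = - g] with the layer part of [theta]. *)
Lemma stationary_layer theta lambda k : (1 <= k <= K)%N ->
  regularized_stationary (loss sigma x y) lambda theta ->
  lambda * at_layer (@frobenius R) theta k ^+ 2
  = H ^+ (K - k) * mean_margin theta.
Proof.
move=> leK [g /(clarke_layer_part leK) gk stat].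
rewrite -dot_layer_part //; apply: oppr_inj.
rewrite -gk -[g]opprK -stat !dotE mulNmx -scalemxAl.
by rewrite [RHS]mxE [in RHS]mxE.
Qed.

End Loss.

(** * From the layer identities to the final inequality *)

Unset Implicit Arguments.
Set Strict Implicit.

Theorem lemma3 (R : realType) (d m K n : nat) (H : R)
    (sigma : 'cV[R]_m -> 'cV[R]_m)
    (x : 'I_n -> 'cV[R]_d) (y : 'I_n -> R)
    (hK : (2 <= K)%N) (hn : (0 < n)%N) (hH : 1 <= H)
    (hx : forall i, frobenius (x i) <= 1)
    (hy : forall i, y i = -1 \/ y i = 1)
    (sigma_hom : pos_homogeneous H sigma)
    (sigma_bound : forall v, frobenius (sigma v) <= frobenius v `^ H)
    (net_lip : forall z : 'cV[R]_d,
       locally_lipschitz (fun t : 'rV[R]_(params d m K) => network sigma t z))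
    (net_chain : forall z : 'cV[R]_d,
       chain_rule (fun t : 'rV[R]_(params d m K) => network sigma t z))
    (loss_chain : chain_rule (loss (K := K) sigma x y))
    (lambda : R) (theta : 'rV[R]_(params d m K))
    (hlambda : 0 < lambda) (theta_neq0 : theta != 0)
    (theta_stat : regularized_stationary (loss sigma x y) lambda theta) :
  let Z := degree_sum K H in
  \sum_(1 <= k < K.+1)
     (H ^+ (K - k)) `^ (3 / 2) / Z
     * (at_layer (@spectral R) theta k / at_layer (@frobenius R) theta k)
  >= Num.sqrt lambda * loss sigma x y theta `^ (- (1 / 4 + 1 / (2 * Z))).
Proof.
cbv zeta; set Z := degree_sum K H; set L := loss sigma x y theta.
pose c k := H ^+ (K - k); pose s k := at_layer (@spectral R) theta k.
pose F k := at_layer (@frobenius R) theta k; pose S := mean_margin sigma x y theta.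
pose M := \prod_(1 <= k < K.+1) s k `^ c k.
have c_ge1 k : 1 <= c k by exact: exprn_ege1.
have c_gt0 k : 0 < c k by exact: lt_le_trans ltr01 (c_ge1 k).
have s_ge0 k : 0 <= s k by rewrite /s /at_layer; case: ifP => _; exact: spectral_ge0.
have F_ge0 k : 0 <= F k by rewrite /F /at_layer; case: ifP => _; exact: frobenius_ge0.
have Fk k : (1 <= k <= K)%N -> lambda * F k ^+ 2 = c k * S.
  by move=> leK; exact: (stationary_layer sigma_hom net_lip leK theta_stat).
(* Otherwise every layer has Frobenius norm zero, contradicting [theta != 0]. *)
have S_gt0 : 0 < S.
  rewrite ltNge; apply: contra_neqN theta_neq0 => S_le0.
  apply: params_eq0 => [|k leK]; first exact: ltnW.
  have F2_le0 : F k ^+ 2 <= 0.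
    by rewrite -(pmulr_rle0 _ hlambda) Fk // pmulr_rle0.
  by apply/eqP; rewrite -sqrf_eq0 eq_le F2_le0 sqr_ge0.
(* There are [K >= 2] terms, each at least 1 since [1 <= H]. *)
have Z_ge2 : 2 <= Z.
  rewrite /Z /degree_sum.
  apply: le_trans (_ : \sum_(1 <= k < K.+1) 1 <= _); last first.
    by apply: ler_sum => k _; exact: c_ge1.
  by rewrite sumr_const_nat subSS subn0 ler_nat.
have Z_gt0 : 0 < Z by exact: lt_le_trans Z_ge2.
have M_ge0 : 0 <= M by apply: prodr_ge0 => k _; exact: powR_ge0.
have n_gt0 : 0 < n%:R :> R by rewrite ltr0n.
have LE : L = n%:R^-1 * \sum_(i < n) logistic (y i * network sigma theta (x i)) by [].
have S_ML : S <= M * L.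
  rewrite LE mulrCA ler_pM2l ?invr_gt0 // mulr_sumr; apply: ler_sum => i _.
  apply: margin_le_logistic.
  have -> : `|y i * network sigma theta (x i)| = `|network sigma theta (x i)|.
    by rewrite normrM; case: (hy i) => ->; rewrite ?normrN normr1 mul1r.
  by apply: norm_network => //; exact: ltnW.
have S2_L : S ^+ 2 <= L.
  suff : 2 * S * S <= L + S ^+ 2 by rewrite -mulrA -expr2; lra.
  have -> : L + S ^+ 2 = n%:R^-1 *
      \sum_(i < n) (logistic (y i * network sigma theta (x i)) + S ^+ 2).
    by rewrite big_split /= sumr_const card_ord -[S ^+ 2 *+ _]mulr_natl mulrDr
      mulKf ?gt_eqF.
  rewrite [in X in _ * X]/S /mean_margin mulrCA ler_pM2l ?invr_gt0 // mulr_sumr.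
  by apply: ler_sum => i _; apply: margin_young; exact: ltW.
(* By stationarity, [q] is the ratio of [F k] to [Num.sqrt (c k)], the same for all layers. *)
pose q := Num.sqrt S / Num.sqrt lambda.
have q_gt0 : 0 < q by rewrite divr_gt0 ?sqrtr_gt0.
have FE k : (1 <= k <= K)%N -> F k = Num.sqrt (c k) * q.
  move=> /Fk /(congr1 Num.sqrt).
  rewrite (sqrtrM _ (ltW hlambda)) (sqrtrM _ (ltW (c_gt0 k))) sqrtr_sqr ger0_norm // => e.
  by rewrite /q mulrA -e mulrC mulKf // gt_eqF // sqrtr_gt0.
(* The exponent 3/2 absorbs the square root in [F k]: one factor [c k] remains, leaving a weighted
   arithmetic mean of the spectral norms. *)
have -> : \sum_(1 <= k < K.+1) (H ^+ (K - k)) `^ (3 / 2) / Z * (s k / F k)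
    = q^-1 * ((\sum_(1 <= k < K.+1) c k * s k) / Z).
  rewrite mulr_suml mulr_sumr; apply: eq_big_nat => k leK.
  rewrite FE // -/(c k).
  have -> : 3 / 2 = 1 + 2^-1 :> R by field.
  rewrite powRD ?gt_eqF ?implybT // powRr1 ?(ltW (c_gt0 k)) //.
  rewrite powR12_sqrt ?(ltW (c_gt0 k)) //.
  have : 0 < Num.sqrt (c k) by rewrite sqrtr_gt0.
  move: (Num.sqrt (c k)) => r r_gt0.
  by field; rewrite !gt_eqF.
have := weighted_am_gm (r := index_iota 1 K.+1) c_gt0 s_ge0 Z_gt0.
rewrite -/M => amgm.
(* AM-GM gives the upper comparison; the lower one, after cancelling [Num.sqrt lambda], is the
   interpolation inequality. *)
apply: le_trans (_ : q^-1 * M `^ (1 / Z) <= _); last by rewrite ler_pM2l ?invr_gt0.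
rewrite /q invf_div -mulrA; apply: ler_wpM2l; first exact: sqrtr_ge0.
rewrite [leRHS]mulrC ler_pdivlMr ?sqrtr_gt0 // [leLHS]mulrC.
exact: powR_interpolation.
Qed.
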